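(* Let $\mathcal K$ be a multiplicative valued difference field with parameter $\rho$ satisfying Axiom 2, and suppose $\rho$ is algebraic. Let $\{a_\eta\}$ be a pc-sequence in $K$ with $a_\eta\leadsto a$ in some extension. Let $P(x)$ be a $\sigma$-polynomial over $K$ such that (i) $P(a_\eta)\leadsto 0$, and (ii) $P_{(\vec L)}(b_\eta)\not\leadsto 0$ whenever $|\vec L|\ge1$ and $\{b_\eta\}$ is a pc-sequence in $K$ equivalent to $\{a_\eta\}$. Let $\Sigma$ be a finite set of $\sigma$-polynomials over $K$. Then there is a pc-sequence $\{b_\eta\}$ in $K$, equivalent to $\{a_\eta\}$, such that $P(b_\eta)\leadsto0$ and $Q(b_\eta)\leadsto Q(a)$ for every non-constant $Q\in\Sigma$.
   Context: A valued difference field $\mathcal K=(K,\Gamma,k;v,\pi)$ is a valued field (surjective valuation $v:K\to\Gamma\cup\{\infty\}$, valuation ring $\mathcal O$, residue map $\pi:\mathcal O\to k$) with a field automorphism $\sigma$ of $K$ satisfying $\sigma(\mathcal O)=\mathcal O$; $\sigma$ induces automorphisms $\sigma(v(x)):=v(\sigma(x))$ of $\Gamma$ and $\bar\sigma(\pi(x)):=\pi(\sigma(x))$ of $k$. It is a multiplicative valued difference field with parameter $\rho$ if $\mathrm{char}\,K=\mathrm{char}\,k=0$ and (Axiom 1), writing $\rho\cdot\gamma:=\sigma(\gamma)$ and $L\cdot\gamma:=\sum_i m_i\sigma^i(\gamma)$ for $L=\sum_i m_i\rho^i\in\mathbb Z[\rho]$: for each $L$, either $L\cdot\gamma>0$ for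 all $\gamma>0$, or $L\cdot\gamma=0$ for all $\gamma>0$, or $L\cdot\gamma<0$ for all $\gamma>0$; and $\rho\cdot\gamma\ge\gamma$ for all $\gamma>0$. All extensions considered are again such fields with the same $\rho$. $\rho$ is algebraic if some nonzero $L\in\mathbb Z[\rho]$ satisfies $L\cdot\gamma=0$ for all $\gamma\in\Gamma$. Axiom 2: for each integer $d>0$ there is $y\in k$ with $\bar\sigma^d(y)\ne y$. A $\sigma$-polynomial over $K$ of order $\le n$ is $P(x)=F(\vec\sigma(x))$, $F\in K[X_0,\dots,X_n]$, $\vec\sigma(x)=(x,\sigma(x),\dots,\sigma^n(x))$; non-constant means $P\notin K$. For $\vec L\in\mathbb N^{n+1}$, $|\vec L|$ is the sum of entries; if $F(\mathbf X+\mathbf Y)=\sum F_{(\vec L)}(\mathbf X)\mathbf Y^{\vec L}$ then $P_{(\vec L)}(x):=F_{(\vec L)}(\vec\sigma(x))$. A pc-sequence is a limit-ordinal-indexed $\{a_\eta\}$ with $v(a_{\eta''}-a_{\eta'})>v(a_{\eta'}-a_\eta)$ for $\eta''>\eta'>\eta\ge\eta_0$ (some $\eta_0$); $a_\eta\leadsto a$ means $v(a-a_{\eta'})>v(a-a_\eta)$ for $\eta'>\eta\ge\eta_0$ (some $\eta_0$). Two pc-sequences are equivalent if they have the same pseudo-limits in all valued field extensions. *)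

(* Defs.v *)
From HB Require Import structures.
From mathcomp Require Import all_boot all_order all_algebra.
From mathcomp.multinomials Require Export mpoly.

Set Implicit Arguments.
Unset Strict Implicit.
Unset Printing Implicit Defensive.

Import Order.TTheory GRing.Theory Num.Theory.
Local Open Scope ring_scope.

(** * Ordered abelian groups *)

(* [porderZmodType] is only a join: it does not relate the order to [+]. *)
HB.mixin Record isOrderedAbelianGroup G of Num.POrderedZmodule G := {
  oag_total : total (<=%R : rel G);
  oag_leD2l : forall z x y : G, x <= y -> z + x <= z + y
}.

#[short(type="oagType")]
HB.structure Definition OrderedAbelianGroup :=
  { G of Num.POrderedZmodule G & isOrderedAbelianGroup G }.

(** * The extended group, with [None] for infinity *)

Section Extended.
Variable G : oagType.
Implicit Types x y : option G.

Definition vle x y : bool :=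
  match x, y with
  | _, None => true
  | None, Some _ => false
  | Some g, Some h => g <= h
  end.

Definition vlt x y : bool :=
  match x, y with
  | None, _ => false
  | Some _, None => true
  | Some g, Some h => g < h
  end.

Definition vmin x y : option G := if vle x y then x else y.

Definition vadd x y : option G :=
  match x, y with
  | Some g, Some h => Some (g + h)
  | _, _ => None
  end.

End Extended.

(** * Valued fields *)

(* The residue map is a total function on the field, but it is constrained, and
   used, on the valuation ring only. *)
Record valuedField := ValuedField {
  vf_field :> fieldType;
  vgroup : oagType;
  vresidue : fieldType;
  vval : vf_field -> option vgroup;
  vres : vf_field -> vresidue;
  vval_eq_infty : forall x, vval x = None <-> x = 0;
  vvalM : forall x y, vval (x * y) = vadd (vval x) (vval y);
  vvalD : forall x y, vle (vmin (vval x) (vval y)) (vval (x + y));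
  vval_surj : forall g : vgroup, exists x, vval x == Some g;
  vresD : forall x y, vle (Some 0) (vval x) -> vle (Some 0) (vval y) ->
    vres (x + y) = vres x + vres y;
  vresM : forall x y, vle (Some 0) (vval x) -> vle (Some 0) (vval y) ->
    vres (x * y) = vres x * vres y;
  vres1 : vres 1 = 1;
  vres_eq0 : forall x, vle (Some 0) (vval x) ->
    (vres x = 0 <-> vlt (Some 0) (vval x));
  vres_surj : forall y : vresidue,
    exists x, vle (Some 0) (vval x) && (vres x == y)
}.

Definition vring (K : valuedField) : {pred K} :=
  fun x => vle (Some 0) (vval x).
Arguments vring : clear implicits.

Record vfExt (K K' : valuedField) := VfExt {
  ext_field :> {rmorphism K -> K'};
  ext_group : {additive vgroup K -> vgroup K'};
  ext_res : {rmorphism vresidue K -> vresidue K'};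
  ext_group_mono : {mono ext_group : g h / g <= h};
  ext_val : forall x, vval (ext_field x) = omap ext_group (vval x);
  ext_vres : forall x, x \in vring K -> vres (ext_field x) = ext_res (vres x)
}.

(** * Pseudo-convergence *)

(* Well-orders of limit order type; they stand for limit ordinals as index
   sets. *)
Definition limit_order d (I : orderType d) : Prop :=
  [/\ inhabited I,
      well_founded (fun i j : I => (i < j)%O)
    & forall i : I, exists j : I, (i < j)%O].

Section PseudoConvergence.
Variables (d : Order.disp_t) (I : orderType d) (K : valuedField).
Implicit Types (a b : I -> K).

Definition pc_seq a : Prop :=
  exists i0 : I, forall i j k : I, (i0 <= i)%O -> (i < j)%O -> (j < k)%O ->
    vlt (vval (a j - a i)) (vval (a k - a j)).

Definition pseudolim a (x : K) : Prop :=
  exists i0 : I, forall i j : I, (i0 <= i)%O -> (i < j)%O ->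
    vlt (vval (x - a i)) (vval (x - a j)).

End PseudoConvergence.

(* [K'] is an arbitrary valued field extension: no automorphism is asked to
   extend to it. *)
Definition pc_equiv d (I : orderType d) d' (J : orderType d') (K : valuedField)
    (a : I -> K) (b : J -> K) : Prop :=
  forall (K' : valuedField) (f : vfExt K K') (x : K'),
    pseudolim (fun i => f (a i)) x <-> pseudolim (fun j => f (b j)) x.

(** * Valued difference fields *)

Record vdField := VdField {
  vdf_vfield :> valuedField;
  vsigma : {rmorphism vdf_vfield -> vdf_vfield};
  vsigma_bij : bijective vsigma;
  vsigma_vring : forall y : vdf_vfield,
    y \in vring vdf_vfield <->
    exists2 x : vdf_vfield, x \in vring vdf_vfield & vsigma x = y
}.

Section Induced.
Variable K : vdField.

(* The maps induced on the value group and the residue field, computed from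
   chosen preimages; [vval_sigma] and [vres_sigma] say that the choice is
   irrelevant. *)
Definition gsigma (g : vgroup K) : vgroup K :=
  odflt 0 (vval (vsigma K (xchoose (vval_surj g)))).

Definition ksigma (y : vresidue K) : vresidue K :=
  vres (vsigma K (xchoose (vres_surj y))).

End Induced.

Section ExtendedTheory.
Variable G : oagType.
Implicit Types (g h : G) (s t u : option G).

Lemma oag_leD2lE g h k : (g + h <= g + k) = (h <= k).
Proof.
by apply/idP/idP => [/(oag_leD2l (- g))|/oag_leD2l->//]; rewrite !addKr.
Qed.

Lemma vle_refl s : vle s s.
Proof. by case: s => /=. Qed.

Lemma vle_anti s t : vle s t -> vle t s -> s = t.
Proof. by case: s t => [g|] [h|] //= gh hg; congr Some; apply/le_anti/andP. Qed.

Lemma vle_trans t s u : vle s t -> vle t u -> vle s u.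
Proof. by case: s t u => [g|] [h|] [k|] //=; apply: le_trans. Qed.

Lemma vltNge s t : vlt s t = ~~ vle t s.
Proof.
case: s t => [g|] [h|] //=; rewrite lt_neqAle.
case: (eqVneq g h) => [->|gh] /=; first by rewrite lexx.
case: (boolP (h <= g)) => [hg|]; last by case/orP: (oag_total g h) => ->.
by apply/negbTE/negP => le_gh; case/eqP: gh; apply/le_anti/andP.
Qed.

End ExtendedTheory.

Section ValuationTheory.
Variable K : valuedField.
Implicit Types x y : K.

Lemma vval0 : vval (0 : K) = None.
Proof. exact/vval_eq_infty. Qed.

Lemma vval_neq0 x : x != 0 -> exists g, vval x = Some g.
Proof.
move=> x0; case vx: (vval x) => [g|]; first by exists g.
by move/vval_eq_infty/eqP: vx; rewrite (negbTE x0).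
Qed.

Lemma vval1 : vval (1 : K) = Some 0.
Proof.
have [g vg] := vval_neq0 (oner_neq0 K).
have := vvalM (1 : K) 1; rewrite mulr1 vg /= => -[/esym/eqP].
by rewrite -subr_eq0 addrK => /eqP->.
Qed.

Lemma vringE x : (x \in vring K) = vle (Some 0) (vval x).
Proof. by []. Qed.

Lemma vle_div x y : x != 0 -> vle (vval x) (vval y) = (y / x \in vring K).
Proof.
move=> x0; rewrite -[in LHS](divfK x0 y) vvalM vringE.
have [g ->] := vval_neq0 x0; case: (vval _) => [h|] //=.
by rewrite addrC -{1}(addr0 g) oag_leD2lE.
Qed.

Lemma vringN x : x \in vring K -> - x \in vring K.
Proof.
have ON1 : vle (Some 0) (vval (-1 : K)).
  have : vval (-1 * -1 : K) = Some 0 by rewrite mulrNN mulr1 vval1.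
  rewrite vvalM; case: (vval (-1)) => //= g [g0].
  case/orP: (oag_total 0 g) => // gle.
  by have := oag_leD2l g _ _ gle; rewrite g0 addr0.
rewrite !vringE -(mulN1r x) vvalM; move: ON1.
case: (vval x) (vval (-1)) => [g|] [h|] //= h0 g0.
by apply: (le_trans h0); rewrite -{1}(addr0 h) oag_leD2lE.
Qed.

Lemma vringD x y : x \in vring K -> y \in vring K -> x + y \in vring K.
Proof.
rewrite !vringE => Ox Oy; apply: vle_trans (vvalD x y).
by rewrite /vmin; case: ifP.
Qed.

End ValuationTheory.

Section InducedTheory.
Variable K : vdField.
Implicit Types x y : K.

Lemma vring_sigma x : (vsigma K x \in vring K) = (x \in vring K).
Proof.
apply/idP/idP => [|Ox]; last by apply/vsigma_vring; exists x.
by case/vsigma_vring => y Oy /(bij_inj (@vsigma_bij K)) <-.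
Qed.

Lemma vle_sigma x y :
  vle (vval (vsigma K x)) (vval (vsigma K y)) = vle (vval x) (vval y).
Proof.
have [->|x0] := eqVneq x 0; last first.
  by rewrite !vle_div ?fmorph_eq0 // -fmorph_div vring_sigma.
rewrite rmorph0 vval0; have [->|y0] := eqVneq y 0; first by rewrite rmorph0 vval0.
have [g ->] := vval_neq0 y0.
by have /vval_neq0[h ->] // : vsigma K y != 0 by rewrite fmorph_eq0.
Qed.

Lemma vval_sigma x : vval (vsigma K x) = omap (@gsigma K) (vval x).
Proof.
have [->|x0] := eqVneq x 0; first by rewrite rmorph0 vval0.
have [g vx] := vval_neq0 x0; rewrite vx /= /gsigma.
have /eqP := xchooseP (vval_surj g); set z := xchoose _ => vz.
have -> : vval (vsigma K x) = vval (vsigma K z).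
  by apply: vle_anti; rewrite vle_sigma vx vz vle_refl.
have [z0|z0] := eqVneq z 0; first by rewrite z0 vval0 in vz.
by have /vval_neq0[h ->] // : vsigma K z != 0 by rewrite fmorph_eq0.
Qed.

Lemma vres_sigma x : x \in vring K -> vres (vsigma K x) = ksigma (vres x).
Proof.
rewrite /ksigma => Ox; have /andP[] := xchooseP (vres_surj (vres x)).
set z := xchoose _ => Oz /eqP zx; clearbody z.
have Od : x - z \in vring K by rewrite vringD ?vringN.
have d0 : vres (x - z) = 0.
  by apply: (addIr (vres z)); rewrite -vresD // subrK add0r.
have sd0 : vres (vsigma K (x - z)) = 0.
  apply/vres_eq0; first by rewrite -vringE vring_sigma.
  move/vres_eq0: d0 => /(_ Od); rewrite !vltNge -(vval1 K).
  by rewrite -{2}(rmorph1 (vsigma K)) vle_sigma.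
have Osd : vsigma K (x - z) \in vring K by rewrite vring_sigma.
have Osz : vsigma K z \in vring K by rewrite vring_sigma.
by have := vresD Osd Osz; rewrite -rmorphD subrK sd0 add0r.
Qed.

End InducedTheory.

(** * Multiplicative valued difference fields *)

Section Multiplicative.
Variable K : vdField.

(* [L . g] for [L] in Z[rho]; rho is handled formally, as the variable of
   [{poly int}], since it enters only through its action on the value group. *)
Definition rho_act (L : {poly int}) (g : vgroup K) : vgroup K :=
  \sum_(i < size L) iter i (@gsigma K) g *~ L`_i.

Definition rho_gt0 (L : {poly int}) : Prop :=
  forall g : vgroup K, 0 < g -> 0 < rho_act L g.
Definition rho_eq0 (L : {poly int}) : Prop :=
  forall g : vgroup K, 0 < g -> rho_act L g = 0.
Definition rho_lt0 (L : {poly int}) : Prop :=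
  forall g : vgroup K, 0 < g -> rho_act L g < 0.

Record multiplicative_vdf : Prop := MultiplicativeVdf {
  mvdf_pchar : [pchar K] =i pred0;
  mvdf_pchar_res : [pchar (vresidue K)] =i pred0;
  mvdf_axiom1 : forall L, [\/ rho_gt0 L, rho_eq0 L | rho_lt0 L];
  mvdf_rho_ge1 : forall g : vgroup K, 0 < g -> g <= gsigma g
}.

Definition rho_algebraic : Prop :=
  exists2 L : {poly int}, L != 0 & forall g : vgroup K, rho_act L g = 0.

Definition axiom2 : Prop :=
  forall d : nat, (0 < d)%N ->
    exists y : vresidue K, iter d (@ksigma K) y <> y.

End Multiplicative.

(* Having the same rho: every element of Z[rho] has the same sign on both
   sides. *)
Definition same_rho (K K' : vdField) : Prop :=
  forall L : {poly int},
    [/\ rho_gt0 K L <-> rho_gt0 K' L,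
        rho_eq0 K L <-> rho_eq0 K' L
      & rho_lt0 K L <-> rho_lt0 K' L].

Record mvdfExt (K K' : vdField) := MvdfExt {
  mext_vf :> vfExt K K';
  mext_sigma : forall x : K, mext_vf (vsigma K x) = vsigma K' (mext_vf x);
  mext_mvdf : multiplicative_vdf K';
  mext_rho : same_rho K K'
}.

(** * Sigma-polynomials *)

(* A pair [(n, F)] with [F] in n.+1 variables, of order at most n. *)
Definition sigma_poly (R : comNzRingType) := {n : nat & {mpoly R[n.+1]}}.

Definition sp_eval (K : vdField) (P : sigma_poly K) (x : K) : K :=
  (tagged P).@[fun i : 'I_(tag P).+1 => iter i (vsigma K) x].

Definition sp_nonconst (R : comNzRingType) (P : sigma_poly R) : Prop :=
  ~ exists c : R, tagged P = c%:MP.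

Definition sp_map (R S : comNzRingType) (f : {rmorphism R -> S})
    (P : sigma_poly R) : sigma_poly S :=
  Tagged (fun n => {mpoly S[n.+1]}) (map_mpoly f (tagged P)).

(* [F (X + Y)], as a polynomial in Y with coefficients polynomials in X. *)
Definition mpoly_shift n (R : comNzRingType) (F : {mpoly R[n]}) :
    {mpoly {mpoly R[n]}[n]} :=
  mmap (fun c : R => c%:MP%:MP) (fun i : 'I_n => ('X_i)%:MP + 'X_i) F.

Definition sp_taylor (R : comNzRingType) (P : sigma_poly R)
    (L : 'X_{1..(tag P).+1}) : sigma_poly R :=
  Tagged (fun n => {mpoly R[n.+1]}) (mpoly_shift (tagged P))@_L.
Arguments sp_taylor {R} P L.

(* Main.v *)
Require Import Defs.
From mathcomp Require Import all_boot all_order all_algebra.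
From Stdlib Require Import ClassicalEpsilon.

Set Implicit Arguments.
Unset Strict Implicit.
Unset Printing Implicit Defensive.

Import Order.TTheory GRing.Theory.
Local Open Scope ring_scope.

(* Put [theta i = a (next i) - a i] and [b i = a (next i) + mu i * theta i]
   with [mu i] a unit, so that [(b i - a') / theta i] has the residue of [mu i].
   In [Q (b i) - Q a' = \sum_(L != 0) Q_L(a') sigma(b i - a')^L], divided by a
   term [Q_L(a') sigma(theta i)^L] of least value, the residue is a nonzero
   sigma-polynomial in the residue of [mu i]; over a field of characteristic 0
   with [sigma] of infinite order, a suitable [mu i] avoids the zeros of finitely
   many of them.  So [v (Q (b i) - Q a')] is that least value, which increases
   strictly with [i] as every term does.  For [P], this value bounds
   [v (P (a i) - P a')] from below, so [P (a i) ~> 0] puts [v (P a')] above all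
   of them, whence [v (P (b i)) = v (P (b i) - P a')]. *)

(** * Points where polynomials over a field of characteristic 0 do not vanish *)

Lemma meval_muni n (R : comNzRingType) (p : {mpoly R[n.+1]}) (v : 'I_n.+1 -> R) :
  p.@[v] =
  (map_poly (meval (fun i => v (widen_ord (leqnSn n) i))) (muni p)).[v ord_max].
Proof.
rewrite muniE rmorph_sum /= horner_sum mevalE; apply: eq_bigr => m _.
rewrite map_polyZ /= map_polyXn mevalZ mevalX hornerZ hornerXn -mulrA.
congr (_ * _); rewrite big_ord_recr /=; congr (_ * _).
by apply: eq_bigr => i _; rewrite mnmE.
Qed.

(** [p] is recovered from [muni p] by widening the coefficients and substituting the last
    variable. *)
Lemma muni_neq0 n (R : comNzRingType) (p : {mpoly R[n.+1]}) :
  p != 0 -> muni p != 0.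
Proof.
apply: contraNneq => p0.
have -> : p = (map_poly (@mwiden n R) (muni p)).['X_ord_max].
  rewrite muniE rmorph_sum /= horner_sum {1}[p]mpolyE; apply: eq_bigr => m _.
  rewrite map_polyZ /= map_polyXn mwidenZ mwidenX hornerZ hornerXn -scalerAl.
  congr (_ *: _); rewrite mpolyXn -mpolyXD; congr ('X_[_]); apply/mnmP => i.
  rewrite mnmDE mulmnE mnm1E; case: (unliftP ord_max i) => [j|] ->.
    have -> : lift ord_max j = widen_ord (leqnSn n) j.
      by apply/val_inj => /=; rewrite /bump leqNgt ltn_ord.
    rewrite mnmwiden_widen mnmE -val_eqE /= gtn_eqF ?ltn_ord //.
    by rewrite mul0n addn0.
  by rewrite mnmwiden_ordmax eqxx mul1n.
by rewrite p0 rmorph0 horner0.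
Qed.

(** In characteristic 0 the first [size p] natural numbers are distinct in [F], one more than [p]
    can have as roots. *)
Lemma poly_nat_nonroot (F : idomainType) (p : {poly F}) :
  [pchar F] =i pred0 -> p != 0 -> exists k : nat, p.[k%:R] != 0.
Proof.
move=> /pcharf0P char0 p0.
have inj_nat : injective (fun k : nat => k%:R : F).
  suff le_inj i j : (i <= j)%N -> i%:R = j%:R :> F -> i = j.
    by move=> i j eq_ij; case/orP: (leq_total i j) => /le_inj->.
  move=> le_ij /eqP; rewrite eq_sym -subr_eq0 -natrB // char0 subn_eq0.
  by move=> le_ji; apply/eqP; rewrite eqn_leq le_ij.
pose rs := [seq k%:R | k <- iota 0 (size p)] : seq F.
have [/(max_poly_roots p0) | ] := boolP (all (root p) rs).
  by rewrite map_inj_uniq ?iota_uniq // size_map size_iota ltnn => /(_ isT).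
by case/allPn => x /mapP[k _ ->] pk; exists k.
Qed.

(** Induction on the number of variables: first keep the leading coefficient in the last variable
    from vanishing, then choose the last coordinate by the one-variable case. *)
Lemma mpoly_nat_nonroot (F : idomainType) n (p : {mpoly F[n]}) :
  [pchar F] =i pred0 -> p != 0 ->
  exists t : 'I_n -> nat, p.@[fun i => (t i)%:R] != 0.
Proof.
move=> char0; elim: n p => [|n IHn] p p0.
  exists (fun=> 0%N); rewrite (nvar0_mpolyC_eq p) // mevalC.
  by apply: contraNneq p0 => c0; rewrite (nvar0_mpolyC_eq p) // c0 mpolyC0.
have [|t tP] := IHn (lead_coef (muni p)); first by rewrite lead_coef_eq0 muni_neq0.
set q := map_poly (meval (fun i => (t i)%:R : F)) (muni p).
have q0 : q != 0.
  apply: contraNneq tP => q0.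
  by rewrite lead_coefE -coef_map -/q q0 coef0.
have [k kP] := poly_nat_nonroot char0 q0.
exists (fun i => if unlift ord_max i is Some j then t j else k).
rewrite meval_muni unlift_none; congr (_ != 0): kP; congr (_.[_]).
apply: eq_map_poly => c; apply: meval_eq => i.
have -> : widen_ord (leqnSn n) i = lift ord_max i.
  by apply/val_inj => /=; rewrite /bump leqNgt ltn_ord.
by rewrite liftK.
Qed.

(** Interpolation at distinct nodes: the Vandermonde determinant is a product of nonzero
    differences. *)
Lemma vandermonde_surj (F : fieldType) n (z w : 'I_n -> F) : injective z ->
  exists c : 'I_n -> F, forall l, \sum_(j < n) c j * z l ^+ j = w l.
Proof.
move=> inj_z; pose V := Vandermonde n (\row_j z j).
have Vu : V \in unitmx.
  rewrite unitmxE det_Vandermonde unitfE.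
  apply/prodf_neq0 => i _; apply/prodf_neq0 => j lt_ij; rewrite !mxE subr_eq0.
  by rewrite (inj_eq inj_z) -val_eqE gtn_eqF.
exists (fun j => ((\row_l w l) *m invmx V) 0 j) => l.
have := mulmxKV Vu (\row_l w l) => /matrixP/(_ 0 l).
by rewrite !mxE => <-; apply: eq_bigr => j _; rewrite !mxE.
Qed.

(** Meant for [z l] the [l]-th conjugate of a residue. Natural coefficients are fixed by every
    automorphism, so the sums are then the conjugates of a single element, at which all the [G] are
    nonzero. *)
Lemma common_nat_nonroot (F : fieldType) N (z : nat -> F)
    (s : seq {n : nat & {mpoly F[n.+1]}}) :
  [pchar F] =i pred0 -> {in gtn N.+1 &, injective z} ->
  (forall G, G \in s -> (tag G <= N)%N /\ tagged G != 0) ->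
  exists t : 'I_N.+1 -> nat, forall G, G \in s ->
    (tagged G).@[fun l : 'I_(tag G).+1 => \sum_(j < N.+1) (t j)%:R * z l ^+ j] != 0.
Proof.
move=> char0 inj_z sP.
(* [G] read as a polynomial in the unknown coefficients [t]. *)
pose lin (G : {n : nat & {mpoly F[n.+1]}}) : {mpoly F[N.+1]} :=
  tagged G \mPo [tuple \sum_(j < N.+1) (z l ^+ j) *: 'X_j | l < (tag G).+1].
have linE G t : (lin G).@[t] =
    (tagged G).@[fun l : 'I_(tag G).+1 => \sum_(j < N.+1) t j * z l ^+ j].
  rewrite comp_mpoly_meval; apply: meval_eq => l.
  rewrite tnth_mktuple rmorph_sum /=; apply: eq_bigr => j _.
  by rewrite mevalZ mevalXU mulrC.
have lin_neq0 G : G \in s -> lin G != 0.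
  case/sP => leN G0; have [w wP] := mpoly_nat_nonroot char0 G0.
  (* The substitution reaches every point, so [lin G = 0] would force [G] to vanish at [w]. As [G]
     may use fewer than [N.+1] variables, the target is padded with 0. *)
  have [|c cP] := @vandermonde_surj F N.+1 (fun l => z l)
    (fun l => if (l < (tag G).+1)%N then (w (inord l))%:R else 0).
    by move=> i j /inj_z eq_ij; apply/val_inj/eq_ij; rewrite inE ltn_ord.
  apply: contraNneq wP => lin0; have := linE G c; rewrite lin0 meval0 => ->.
  apply/eqP/meval_eq => l; have ltN := leq_trans (ltn_ord l) (_ : _ <= N.+1)%N.
  by have := cP (Ordinal (ltN leN)); rewrite /= ltn_ord inord_val => ->.
(* A point where the product is nonzero serves all the [G] at once. *)
have [|t tP] := @mpoly_nat_nonroot F _ (\prod_(G <- s) lin G) char0.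
  by rewrite prodf_seq_neq0; apply/allP => G /lin_neq0->.
exists t => G Gs; rewrite -(linE G (fun j => (t j)%:R)).
apply: contraNneq tP => G0; rewrite rmorph_prod /=.
by rewrite prodf_seq_eq0; apply/hasP; exists G; rewrite ?G0 ?eqxx.
Qed.

(** * Order on values; arithmetic of valuations and residues *)

Section ExtendedOrder.
Variable G : oagType.
Implicit Types s t u : option G.

Lemma vle_total s t : vle s t || vle t s.
Proof. by case: s t => [g|] [h|] //=; apply: oag_total. Qed.

Lemma vltW s t : vlt s t -> vle s t.
Proof. by rewrite vltNge; case/orP: (vle_total s t) => ->. Qed.

Lemma vlt_irr s : vlt s s = false.
Proof. by rewrite vltNge vle_refl. Qed.

Lemma vle_lt_trans t s u : vle s t -> vlt t u -> vlt s u.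
Proof. by rewrite !vltNge => le_st; apply: contra => /vle_trans; apply. Qed.

Lemma vlt_le_trans t s u : vlt s t -> vle t u -> vlt s u.
Proof. by rewrite !vltNge => lt_st le_tu; apply: contra lt_st; apply: vle_trans. Qed.

Lemma vltNgeP s t : ~~ vlt s t -> vle t s.
Proof. by rewrite vltNge negbK. Qed.

Lemma vmin_exists (T : eqType) (w : T -> option G) (s : seq T) : s != [::] ->
  exists2 x, x \in s & forall y, y \in s -> vle (w x) (w y).
Proof.
elim: s => // x s IHs _; have [->|/IHs[y ys ymin]] := eqVneq s [::].
  by exists x; rewrite ?inE // => y; rewrite inE => /eqP->; apply: vle_refl.
have /orP[le_xy|le_yx] := vle_total (w x) (w y).
  exists x => [|u]; rewrite inE ?eqxx // => /orP[/eqP->|/ymin]; first exact: vle_refl.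
  exact: vle_trans.
by exists y => [|u]; rewrite inE ?ys ?orbT // => /orP[/eqP->|/ymin].
Qed.

End ExtendedOrder.

Section Valuation.
Variable K : valuedField.
Implicit Types x y z : K.

Lemma vvalN x : vval (- x) = vval x.
Proof.
have [->|x0] := eqVneq x 0; first by rewrite oppr0.
have ON1 : (-1 : K) \in vring K by rewrite vringN // vringE vval1 vle_refl.
apply: vle_anti; rewrite vle_div ?oppr_eq0 // ?invrN ?mulrN ?mulNr divff //.
Qed.

Lemma vvalBC x y : vval (x - y) = vval (y - x).
Proof. by rewrite -vvalN opprB. Qed.

Lemma vvalD_ge (g : option (vgroup K)) x y :
  vle g (vval x) -> vle g (vval y) -> vle g (vval (x + y)).
Proof.
move=> gx gy; apply: vle_trans (vvalD x y).
by rewrite /vmin; case: ifP.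
Qed.

Lemma vvalD_gt (g : option (vgroup K)) x y :
  vlt g (vval x) -> vlt g (vval y) -> vlt g (vval (x + y)).
Proof.
move=> gx gy; apply: vlt_le_trans (vvalD x y).
by rewrite /vmin; case: ifP.
Qed.

Lemma vvalDl x y : vlt (vval x) (vval y) -> vval (x + y) = vval x.
Proof.
move=> lt_xy; apply: vle_anti; last by rewrite vvalD_ge ?vle_refl ?vltW.
apply: vltNgeP; apply/negP => lt_xxy.
have := vvalD_gt lt_xxy (_ : vlt _ (vval (- y))).
by rewrite vvalN addrK vlt_irr => /(_ lt_xy).
Qed.

Lemma vvalDr x y : vlt (vval y) (vval x) -> vval (x + y) = vval y.
Proof. by rewrite addrC; apply: vvalDl. Qed.

Lemma vvalBl x y : vlt (vval x) (vval y) -> vval (x - y) = vval x.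
Proof. by move=> lt_xy; rewrite vvalDl ?vvalN. Qed.

Lemma vlt_neq0 x (g : option (vgroup K)) : vlt (vval x) g -> x != 0.
Proof. by apply: contraTneq => ->; rewrite vval0. Qed.

Lemma vle_mul2l x y z : x != 0 ->
  vle (vval (x * y)) (vval (x * z)) = vle (vval y) (vval z).
Proof.
case/vval_neq0 => g vx; rewrite !vvalM vx.
by case: (vval y) (vval z) => [h|] [k|] //=; rewrite oag_leD2lE.
Qed.

Lemma vlt_mul2l x y z : x != 0 ->
  vlt (vval (x * y)) (vval (x * z)) = vlt (vval y) (vval z).
Proof. by move=> x0; rewrite !vltNge vle_mul2l. Qed.

Lemma vval_mul_unit x y : vval y = Some 0 -> vval (x * y) = vval x.
Proof. by rewrite vvalM => ->; case: (vval x) => //= g; rewrite addr0. Qed.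

Lemma vringM x y : x \in vring K -> y \in vring K -> x * y \in vring K.
Proof.
have [->|x0] := eqVneq x 0; first by rewrite mul0r.
rewrite !vringE => Ox Oy; apply: vle_trans Ox _.
by rewrite -[X in vle (vval X) _]mulr1 vle_mul2l // vval1.
Qed.

Lemma vring1 : 1 \in vring K.
Proof. by rewrite vringE vval1 vle_refl. Qed.

Lemma vring0 : 0 \in vring K.
Proof. by rewrite vringE vval0. Qed.

Lemma vringX x m : x \in vring K -> x ^+ m \in vring K.
Proof.
by move=> Ox; elim: m => [|m IHm]; rewrite ?expr0 ?vring1 // exprS vringM.
Qed.

Lemma vring_nat m : m%:R \in vring K.
Proof. by elim: m => [|m IHm]; rewrite ?vring0 // -natr1 vringD ?vring1. Qed.

Lemma vring_sum (T : eqType) (r : seq T) (h : T -> K) :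
  (forall i, i \in r -> h i \in vring K) -> \sum_(i <- r) h i \in vring K.
Proof.
move=> Oh; rewrite big_seq; elim/big_ind: _ => //; [exact: vring0|exact: vringD].
Qed.

Lemma vring_prod (T : Type) (r : seq T) (h : T -> K) :
  (forall i, h i \in vring K) -> \prod_(i <- r) h i \in vring K.
Proof.
by move=> Oh; elim/big_ind: _ => //; [exact: vring1|exact: vringM].
Qed.

Lemma vres0 : vres (0 : K) = 0.
Proof. by apply/vres_eq0; rewrite vval0. Qed.

Lemma vresX x m : x \in vring K -> vres (x ^+ m) = vres x ^+ m.
Proof.
move=> Ox; elim: m => [|m IHm]; first by rewrite !expr0 vres1.
by rewrite !exprS vresM ?IHm // -vringE vringX.
Qed.

Lemma vres_nat m : vres (m%:R : K) = m%:R.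
Proof.
elim: m => [|m IHm]; first exact: vres0.
by rewrite -!natr1 vresD ?IHm ?vres1 // -vringE ?vring_nat ?vring1.
Qed.

Lemma vres_sum (T : eqType) (r : seq T) (h : T -> K) :
  (forall i, i \in r -> h i \in vring K) ->
  vres (\sum_(i <- r) h i) = \sum_(i <- r) vres (h i).
Proof.
elim: r => [|i r IHr] Oh; first by rewrite !big_nil vres0.
have Or j : j \in r -> h j \in vring K by move=> jr; rewrite Oh // inE jr orbT.
rewrite !big_cons vresD ?IHr // -vringE; last exact: vring_sum.
by rewrite Oh // inE eqxx.
Qed.

Lemma vres_prod (T : Type) (r : seq T) (h : T -> K) :
  (forall i, h i \in vring K) ->
  vres (\prod_(i <- r) h i) = \prod_(i <- r) vres (h i).
Proof.
move=> Oh; elim: r => [|i r IHr]; first by rewrite !big_nil vres1.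
by rewrite !big_cons vresM ?IHr //; [exact: Oh|exact: vring_prod].
Qed.

Lemma vres_small x y : x \in vring K -> vlt (Some 0) (vval y) ->
  vres (x + y) = vres x.
Proof.
move=> Ox y_small; have Oy := vltW y_small.
by rewrite vresD // (_ : vres y = 0) ?addr0 //; apply/vres_eq0.
Qed.

Lemma vres_eqP x y : x \in vring K -> y \in vring K ->
  vres x = vres y <-> vlt (Some 0) (vval (x - y)).
Proof.
move=> Ox Oy; have Od : x - y \in vring K by rewrite vringD ?vringN.
split=> [eq_xy|xy_small]; last by rewrite -(subrK y x) addrC vres_small.
by apply/vres_eq0 => //; apply: (addIr (vres y)); rewrite -vresD // subrK add0r.
Qed.

Lemma vval_unit x : x \in vring K -> vres x != 0 -> vval x = Some 0.
Proof.
move=> Ox; apply: contraNeq => /eqP x_nonunit; apply/eqP/vres_eq0 => //.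
by rewrite vltNge; apply/negP => /vle_anti/(_ Ox).
Qed.

End Valuation.

(** * Behaviour of values under extensions and under iterates of [sigma] *)

Section Extension.
Variables (K K' : valuedField) (f : vfExt K K').

Lemma vle_ext (x y : K) : vle (vval (f x)) (vval (f y)) = vle (vval x) (vval y).
Proof.
rewrite !ext_val; case: (vval x) (vval y) => [g|] [h|] //=.
by rewrite ext_group_mono.
Qed.

Lemma vlt_ext (x y : K) : vlt (vval (f x)) (vval (f y)) = vlt (vval x) (vval y).
Proof. by rewrite !vltNge vle_ext. Qed.

Lemma vring_ext (x : K) : (f x \in vring K') = (x \in vring K).
Proof. by rewrite !vringE -!vval1 -(rmorph1 f) vle_ext. Qed.

Lemma vval_ext_unit (x : K) : vval x = Some 0 -> vval (f x) = Some 0.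
Proof. by rewrite ext_val => -> /=; rewrite raddf0. Qed.

End Extension.

Section Sigma.
Variable K : vdField.
Implicit Types x y : K.
Local Notation sigma := (vsigma K).

Lemma iter_sigma0 l : iter l sigma 0 = 0.
Proof. by elim: l => //= l ->; rewrite rmorph0. Qed.

Lemma iter_sigmaM l x y : iter l sigma (x * y) = iter l sigma x * iter l sigma y.
Proof. by elim: l => //= l ->; rewrite rmorphM. Qed.

Lemma iter_sigmaD l x y : iter l sigma (x + y) = iter l sigma x + iter l sigma y.
Proof. by elim: l => //= l ->; rewrite rmorphD. Qed.

Lemma iter_sigmaB l x y : iter l sigma (x - y) = iter l sigma x - iter l sigma y.
Proof. by elim: l => //= l ->; rewrite rmorphB. Qed.

Lemma iter_sigma_sum l n (t : 'I_n -> nat) x :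
  iter l sigma (\sum_(j < n) (t j)%:R * x ^+ j) =
  \sum_(j < n) (t j)%:R * iter l sigma x ^+ j.
Proof.
elim: l => //= l ->; rewrite rmorph_sum /=; apply: eq_bigr => j _.
by rewrite rmorphM rmorph_nat rmorphXn.
Qed.

Lemma iter_sigma_eq0 l x : (iter l sigma x == 0) = (x == 0).
Proof. by elim: l => //= l <-; rewrite fmorph_eq0. Qed.

Lemma vle_iter_sigma l x y :
  vle (vval (iter l sigma x)) (vval (iter l sigma y)) = vle (vval x) (vval y).
Proof. by elim: l => //= l <-; rewrite vle_sigma. Qed.

Lemma vring_iter_sigma l x : (iter l sigma x \in vring K) = (x \in vring K).
Proof. by elim: l => //= l <-; rewrite vring_sigma. Qed.

Lemma small_iter_sigma l x :
  vlt (Some 0) (vval (iter l sigma x)) = vlt (Some 0) (vval x).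
Proof.
have sigma1 : iter l sigma 1 = 1 by elim: l => //= l ->; rewrite rmorph1.
by rewrite !vltNge -(vval1 K) -[in LHS]sigma1 vle_iter_sigma.
Qed.

End Sigma.

Lemma mnm_neq0_exists n (m : 'X_{1..n}) : m != 0%MM -> exists i, m i != 0%N.
Proof.
move=> m0; apply/existsP; apply: contraNT m0 => /existsPn m0.
by apply/eqP/mnmP => i; rewrite mnm0E; apply/eqP; move: (m0 i); rewrite negbK.
Qed.

(** * Terms of least value in a sigma-polynomial *)

Section Dominant.
Variables (K : vdField) (n : nat) (H : {mpoly K[n.+1]}).
Implicit Types (u w y : K) (m : 'X_{1..n.+1}).
Local Notation sigma := (vsigma K).
Local Notation seval y := H.@[fun i : 'I_n.+1 => iter i sigma y].

Definition sigma_mon y m : K := \prod_(i < n.+1) iter i sigma y ^+ m i.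

Definition sigma_term y m : K := H@_m * sigma_mon y m.

Definition nonconst_supp : seq 'X_{1..n.+1} :=
  [seq m <- msupp H | m != 0%MM].

(** Several exponents may be dominant at the same [y]; ties are resolved later by a generic choice
    of residue. *)
Definition dominant y m : Prop :=
  m \in nonconst_supp /\
  forall m', m' \in nonconst_supp ->
    vle (vval (sigma_term y m)) (vval (sigma_term y m')).

Lemma sigma_monM u w m : sigma_mon (u * w) m = sigma_mon u m * sigma_mon w m.
Proof.
rewrite -big_split /=; apply: eq_bigr => i _.
by rewrite iter_sigmaM exprMn.
Qed.

Lemma sigma_mon_neq0 y m : y != 0 -> sigma_mon y m != 0.
Proof.
by move=> y0; apply/prodf_neq0 => i _; rewrite expf_neq0 // iter_sigma_eq0.
Qed.

Lemma vring_sigma_mon y m : y \in vring K -> sigma_mon y m \in vring K.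
Proof. by move=> Oy; apply: vring_prod => i; rewrite vringX ?vring_iter_sigma. Qed.

(** Some [m i] is positive, so one factor has positive value, since [sigma] preserves positivity;
    the other factors are integral. *)
Lemma small_sigma_mon y m : m != 0%MM ->
  vlt (Some 0) (vval y) -> vlt (Some 0) (vval (sigma_mon y m)).
Proof.
move=> m0 y_small; have Oy : y \in vring K := vltW y_small.
have smallM x z : vlt (Some 0) (vval x) -> z \in vring K ->
    vlt (Some 0) (vval (x * z)).
  rewrite vringE vvalM; case: (vval x) (vval z) => [g|] [h|] //= g_gt0 h_ge0.
  by apply: lt_le_trans g_gt0 _; rewrite -{1}(addr0 g) oag_leD2lE.
have [i mi] := mnm_neq0_exists m0.
rewrite /sigma_mon (bigD1 i) //=; apply: (smallM).
  rewrite -(prednK (n := m i)) ?lt0n // exprS; apply: smallM.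
    by rewrite small_iter_sigma.
  by rewrite vringX ?vring_iter_sigma.
rewrite big_mkcond; apply: vring_prod => j.
by case: ifP => _; rewrite ?vring1 ?vringX ?vring_iter_sigma.
Qed.

Lemma nonconst_suppP : (forall c, H <> c%:MP) -> nonconst_supp != [::].
Proof.
move=> Hnc; apply/negP => /eqP supp0; apply: (Hnc H@_0%MM).
apply/mpolyP => m; rewrite mcoeffC; have [->|m0] := eqVneq m 0%MM.
  by rewrite mulr1.
rewrite mulr0; apply: memN_msupp_eq0; apply/negP => mH.
have : m \in nonconst_supp by rewrite mem_filter m0.
by rewrite supp0.
Qed.

Lemma dominant_exists y : (forall c, H <> c%:MP) -> exists m, dominant y m.
Proof.
move=> /nonconst_suppP/(vmin_exists (fun m => vval (sigma_term y m)))[m mS mmin].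
by exists m.
Qed.

Lemma sigma_term_neq0 y m : y != 0 -> m \in nonconst_supp ->
  sigma_term y m != 0.
Proof.
move=> y0; rewrite mem_filter mcoeff_msupp => /andP[_ Hm].
by rewrite mulf_neq0 ?sigma_mon_neq0.
Qed.

(** The dominant exponent may change from [u] to [w]: by minimality the term [m] at [u] is bounded
    by the term [m'] at [u], which gains the positive value of a nonconstant monomial in [w / u]. *)
Lemma dominant_lt u w m m' : vlt (vval u) (vval w) ->
  dominant u m -> dominant w m' ->
  vlt (vval (sigma_term u m)) (vval (sigma_term w m')).
Proof.
move=> lt_uw [mS mmin] [m'S _]; apply: vle_lt_trans (mmin _ m'S) _.
have u0 := vlt_neq0 lt_uw; rewrite -(divfK u0 w) mulrC.
rewrite /sigma_term sigma_monM mulrA -/(sigma_term u m').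
rewrite -[X in vlt (vval X) _]mulr1 vlt_mul2l ?sigma_term_neq0 // vval1.
move: m'S; rewrite mem_filter => /andP[m'0 _]; apply: small_sigma_mon => //.
by rewrite -(vval1 K) -(vlt_mul2l _ _ u0) mulr1 mulrC divfK.
Qed.

Lemma sevalB0E y : seval y - H@_0%MM = \sum_(m <- nonconst_supp) sigma_term y m.
Proof.
rewrite mevalE big_filter; apply/eqP; rewrite subr_eq; apply/eqP.
rewrite (bigID (fun m => m == 0%MM)) /= addrC; congr (_ + _).
have mon0 : H@_0%MM = H@_0%MM * \prod_(i < n.+1) iter i sigma y ^+ 0%MM i.
  by rewrite big1 ?mulr1 // => i _; rewrite mnm0E expr0.
(* If the zero exponent is outside the support, the constant coefficient is 0 and the sum is
   empty. *)
have [H0|H0] := boolP (0%MM \in msupp H).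
  rewrite -big_filter (_ : [seq m <- _ | _] = [:: 0%MM]) ?big_seq1 -?mon0 //.
  apply: perm_small_eq => //; apply: uniq_perm => //; first by rewrite filter_uniq ?msupp_uniq.
  by move=> m; rewrite mem_filter inE; case: eqP => // ->.
rewrite (memN_msupp_eq0 H0) big_seq_cond big1 // => m /andP[mH /eqP m0].
by rewrite -m0 mH in H0.
Qed.

(** Each term at [y * u] is the term at [y] times an integral monomial in [u]. *)
Lemma vle_dominant y u m : y != 0 -> u \in vring K -> dominant y m ->
  vle (vval (sigma_term y m)) (vval (seval (y * u) - H@_0%MM)).
Proof.
move=> y0 Ou [mS mmin]; rewrite sevalB0E vle_div ?sigma_term_neq0 //.
rewrite mulr_suml; apply: vring_sum => m' m'S.
rewrite /sigma_term sigma_monM mulrA mulrAC vringM ?vring_sigma_mon //.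
by rewrite -vle_div ?mmin // sigma_term_neq0.
Qed.

(* [G] is the reduction of [H (y X) - H (0)] divided by its dominant term. *)
Lemma dominant_reduction y m : y != 0 -> dominant y m ->
  exists2 G : {mpoly (vresidue K)[n.+1]}, G != 0 &
    forall u, u \in vring K ->
      G.@[fun i : 'I_n.+1 => vres (iter i sigma u)] != 0 ->
      vval (seval (y * u) - H@_0%MM) = vval (sigma_term y m).
Proof.
move=> y0 [mS mmin]; pose e := sigma_term y m.
have e0 : e != 0 by rewrite sigma_term_neq0.
pose r m' := sigma_term y m' / e.
have Or m' : m' \in nonconst_supp -> r m' \in vring K.
  by move=> m'S; rewrite -vle_div // mmin.
exists (\sum_(m' <- nonconst_supp) vres (r m') *: 'X_[m']).
  (* The coefficient of [G] at [m] is the residue of [e / e], that is 1. *)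
  apply/eqP => /(congr1 (fun p : {mpoly _[_]} => p@_m)).
  rewrite raddf_sum /= mcoeff0 (bigD1_seq m) ?filter_uniq ?msupp_uniq //=.
  rewrite mcoeffZ mcoeffX eqxx mulr1 /r divff // vres1 big1 => [|m' /negbTE m'm].
    by move/eqP; rewrite addr0 oner_eq0.
  by rewrite mcoeffZ mcoeffX m'm mulr0.
move=> u Ou G_neq0; have Ol i : iter i sigma u \in vring K by rewrite vring_iter_sigma.
have -> : seval (y * u) - H@_0%MM =
    e * \sum_(m' <- nonconst_supp) r m' * sigma_mon u m'.
  rewrite sevalB0E mulr_sumr; apply: eq_bigr => m' _.
  by rewrite /r mulrA mulrCA divff // mulr1 /sigma_term sigma_monM mulrA.
apply/vval_mul_unit/vval_unit.
  by apply: vring_sum => m' m'S; rewrite vringM ?vring_sigma_mon ?Or.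
rewrite vres_sum => [|m' m'S]; last by rewrite vringM ?vring_sigma_mon ?Or.
congr (_ != 0): G_neq0; rewrite rmorph_sum /=.
rewrite !big_seq; apply: eq_bigr => m' m'S.
rewrite mevalZ mevalX vresM -?vringE ?Or ?vring_sigma_mon //; congr (_ * _).
rewrite /sigma_mon vres_prod => [|i]; last by rewrite vringX.
by apply: eq_bigr => i _; rewrite vresX.
Qed.

End Dominant.

Lemma vres_iter_sigma (K : vdField) l (x : K) : x \in vring K ->
  vres (iter l (vsigma K) x) = iter l (@ksigma K) (vres x).
Proof.
move=> Ox; elim: l => //= l <-.
by rewrite vres_sigma // vring_iter_sigma.
Qed.

(** * Units with generic residue *)

Section GenericResidue.
Variables (K K' : vdField) (f : mvdfExt K K').

Lemma ext_iter_sigma l (x : K) :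
  f (iter l (vsigma K) x) = iter l (vsigma K') (f x).
Proof. by elim: l => //= l <-; rewrite mext_sigma. Qed.

(** The polynomials live over the residue field of [K'], but [mu] is found in [K]: it is a
    polynomial with natural coefficients in one [y] whose residue has [N.+1] distinct conjugates. *)
Lemma generic_residue
    (s : seq {n : nat & {mpoly (vresidue K')[n.+1]}}) : axiom2 K ->
  (forall G, G \in s -> tagged G != 0) ->
  exists2 mu : K, vval mu = Some 0 & forall G, G \in s ->
    (tagged G).@[fun l : 'I_(tag G).+1 => vres (iter l (vsigma K') (f mu))] != 0.
Proof.
move=> ax2 s_neq0; pose N := (\max_(G <- s) tag G)%N.
(* The power is [N!] because a coincidence among the first [N.+1] conjugates makes [y0] fixed by a
   positive power of at most [N], which divides [N!]. *)
have [y0 y0P] := ax2 _ (fact_gt0 N).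
have [y /andP[Oy /eqP yy0]] := vres_surj y0; rewrite -vringE in Oy.
pose z l := vres (iter l (vsigma K') (f y)).
have Ofy l : iter l (vsigma K') (f y) \in vring K'.
  by rewrite vring_iter_sigma vring_ext.
have z_inj : {in gtn N.+1 &, injective z}.
  have z_neq i j : (i < j)%N -> (j <= N)%N -> z i <> z j.
    move=> lt_ij le_jN /vres_eqP; move/(_ (Ofy _) (Ofy _)).
    (* Equality of residues says that a difference has positive value; this passes through the
       iterate of [sigma] and descends along [f] to [K]. *)
    rewrite -(subnKC (ltnW lt_ij)) iterD -iter_sigmaB small_iter_sigma.
    rewrite -ext_iter_sigma -rmorphB -(vval1 K') -(rmorph1 f) vlt_ext vval1.
    move/vres_eqP; rewrite vring_iter_sigma => /(_ Oy Oy).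
    rewrite vres_iter_sigma // yy0 => y0_fix; case: y0P.
    have /dvdnP[q ->] : (j - i %| N`!)%N.
      by rewrite dvdn_fact // subn_gt0 lt_ij (leq_trans (leq_subr i j)).
    by elim: q => // q IHq; rewrite mulSn addnC iterD -y0_fix.
  move=> i j; rewrite !inE !ltnS => le_iN le_jN eq_ij.
  by case: (ltngtP i j) => // /z_neq; [case/(_ le_jN)|case/(_ le_iN)].
(* Adjoining the polynomial [X_0] forces the residue of [mu] to be nonzero, so that [mu] is a
   unit. *)
pose X0 : {n : nat & {mpoly (vresidue K')[n.+1]}} :=
  Tagged (fun n => {mpoly (vresidue K')[n.+1]}) ('X_ord0 : {mpoly _[1]}).
have [|t tP] := @common_nat_nonroot _ N z (X0 :: s)
  (mvdf_pchar_res (mext_mvdf f)) z_inj.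
  move=> G; rewrite inE => /orP[/eqP->|Gs] /=.
    by split=> //; rewrite -msize_poly_eq0 msizeX.
  split; last exact: s_neq0.
  by rewrite /N; apply: (leq_bigmax_seq (F := fun G => tag G)).
pose mu := \sum_(j < N.+1) (t j)%:R * y ^+ j.
have resE l : vres (iter l (vsigma K') (f mu)) =
    \sum_(j < N.+1) (t j)%:R * z l ^+ j.
  rewrite -ext_iter_sigma iter_sigma_sum rmorph_sum /=.
  rewrite (eq_bigr (fun j : 'I_N.+1 =>
    (t j)%:R * iter l (vsigma K') (f y) ^+ j)) => [|j _]; last first.
    by rewrite rmorphM rmorph_nat rmorphXn ext_iter_sigma.
  rewrite vres_sum => [|j _]; last by rewrite vringM ?vring_nat ?vringX.
  apply: eq_bigr => j _.
  by rewrite vresM -?vringE ?vring_nat ?vringX // vres_nat vresX.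
have genP G : G \in X0 :: s ->
    (tagged G).@[fun l : 'I_(tag G).+1 => vres (iter l (vsigma K') (f mu))] != 0.
  move=> /tP; congr (_ != 0); apply: meval_eq => l.
  by rewrite resE.
exists mu => [|G Gs]; last by apply: genP; rewrite inE Gs orbT.
have Omu : mu \in vring K.
  by apply: vring_sum => j _; rewrite vringM ?vring_nat ?vringX.
have := genP X0 (mem_head _ _); rewrite /= mevalXU /=.
move=> mu_neq0; apply/vval_unit => //; apply: contraNneq mu_neq0.
by rewrite ext_vres // => ->; rewrite rmorph0.
Qed.

End GenericResidue.

(** * Taylor expansion of sigma-polynomials around a point *)

Section SigmaPolyShift.
Variables (K : vdField).
Implicit Type Q : sigma_poly K.

(** Its coefficient at [L] is the Taylor coefficient [Q_(L)(x)]. *)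
Definition sp_shift Q (x : K) : {mpoly K[(tag Q).+1]} :=
  tagged Q \mPo [tuple 'X_i + (iter i (vsigma K) x)%:MP | i < (tag Q).+1].

Lemma meval_sp_shift Q x (w : 'I_(tag Q).+1 -> K) :
  (sp_shift Q x).@[w] = (tagged Q).@[fun i => w i + iter i (vsigma K) x].
Proof.
rewrite comp_mpoly_meval; apply: meval_eq => i.
by rewrite tnth_mktuple mevalD mevalXU mevalC.
Qed.

Lemma sp_evalD Q x y :
  sp_eval Q (x + y) = (sp_shift Q x).@[fun i => iter i (vsigma K) y].
Proof.
rewrite meval_sp_shift; apply: meval_eq => i.
by rewrite addrC iter_sigmaD.
Qed.

Lemma mcoeff0_sp_shift Q x : (sp_shift Q x)@_0%MM = sp_eval Q x.
Proof.
rewrite -[in RHS](addr0 x) sp_evalD; apply/eqP; rewrite eq_sym -subr_eq0.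
rewrite sevalB0E big1_seq // => m; rewrite mem_filter => /= /andP[m0 _].
have [i mi] := mnm_neq0_exists m0.
rewrite /sigma_term /sigma_mon (bigD1 i) //= iter_sigma0 expr0n (negbTE mi).
by rewrite mul0r mulr0.
Qed.

(** A translation is invertible on points: if the shift were constant, [Q] would be constant on all
    natural tuples, hence constant in characteristic 0. *)
Lemma sp_shift_nonconst Q x : [pchar K] =i pred0 -> sp_nonconst Q ->
  forall c, sp_shift Q x <> c%:MP.
Proof.
move=> char0 Qnc c eq_c; case: Qnc; exists c; apply/eqP; rewrite -subr_eq0.
apply/negPn/negP => /(mpoly_nat_nonroot char0)[t]; rewrite mevalB mevalC.
have := meval_sp_shift x (fun i => (t i)%:R - iter i (vsigma K) x).
rewrite eq_c mevalC => ->; rewrite (meval_eq (v2 := fun i => (t i)%:R)).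
  by rewrite subrr eqxx.
by move=> i; rewrite subrK.
Qed.

End SigmaPolyShift.

Lemma sp_eval_map (K K' : vdField) (f : mvdfExt K K') (Q : sigma_poly K) x :
  sp_eval (sp_map f Q) (f x) = f (sp_eval Q x).
Proof.
case: Q => n F; rewrite /sp_eval /=.
elim/mpolyind: F => [|c m p _ _ IHp]; first by rewrite !(raddf0, meval0).
rewrite raddfD /= !mevalD IHp rmorphD; congr (_ + _).
rewrite map_mpolyZ map_mpolyX !mevalZ !mevalX rmorphM rmorph_prod.
congr (_ * _); apply: eq_bigr => i _.
by rewrite rmorphXn ext_iter_sigma.
Qed.

Lemma sp_map_nonconst (K K' : vdField) (f : mvdfExt K K') (Q : sigma_poly K) :
  sp_nonconst Q -> sp_nonconst (sp_map f Q).
Proof.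
move=> Qnc [c eq_c]; apply: Qnc; exists (tagged Q)@_0%MM; apply/mpolyP => m.
rewrite mcoeffC; have [->|m0] := eqVneq m 0%MM; first by rewrite mulr1.
have := congr1 (mcoeff m) eq_c; rewrite mcoeff_map_mpoly mcoeffC (negbTE m0).
by rewrite !mulr0 => /eqP; rewrite fmorph_eq0 => /eqP.
Qed.

(** * Perturbed pc-sequences and their pseudo-limits *)

Section Perturbation.
Variables (d : Order.disp_t) (I : orderType d) (next : I -> I).
Hypothesis nextP : forall i, (i < next i)%O.

Section OneField.
Variables (K : valuedField) (a b mu : I -> K) (i0 : I).
Let theta i := a (next i) - a i.
Hypothesis aP : forall i j k : I, (i0 <= i)%O -> (i < j)%O -> (j < k)%O ->
  vlt (vval (a j - a i)) (vval (a k - a j)).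
Hypothesis mu_unit : forall i, vval (mu i) = Some 0.
Hypothesis bE : forall i, b i = a (next i) + mu i * theta i.

Lemma vval_theta i k : (i0 <= i)%O -> (i < k)%O ->
  vval (a k - a i) = vval (theta i).
Proof.
move=> le0i lt_ik; have lt_in := nextP i.
have dist j l : (i < j)%O -> (j < l)%O -> vval (a l - a i) = vval (a j - a i).
  move=> lt_ij lt_jl; rewrite -(subrK (a j) (a l)) -addrA [LHS]vvalDr //.
  exact: aP.
by case: (ltgtP k (next i)) => [/(dist _ _ lt_ik)->|/(dist _ _ lt_in)->|->].
Qed.

Lemma theta_lt i k : (i0 <= i)%O -> (i < k)%O ->
  vlt (vval (theta i)) (vval (theta k)).
Proof. by move=> le0i lt_ik; rewrite -(vval_theta le0i lt_ik); apply: aP. Qed.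

Lemma vval_mu_theta i : vval (mu i * theta i) = vval (theta i).
Proof. by rewrite mulrC vval_mul_unit. Qed.

Lemma vval_perturb_base i k : (i0 <= i)%O -> (i < k)%O ->
  vval (b k - a i) = vval (theta i).
Proof.
move=> le0i lt_ik; have lt_in := lt_trans lt_ik (nextP k).
have v_base := vval_theta le0i lt_in.
by rewrite bE addrAC [LHS]vvalDl v_base // vval_mu_theta theta_lt.
Qed.

(** [b k] is closer to [a (next i)] than [theta i], whereas [b i] lies exactly at the distance of
    [theta i] from it. *)
Lemma vval_perturb i k : (i0 <= i)%O -> (i < k)%O ->
  vval (b k - b i) = vval (theta i).
Proof.
move=> le0i lt_ik; rewrite [b i]bE opprD addrA [LHS]vvalDr vvalN vval_mu_theta //.
have lt_th := theta_lt le0i lt_ik; have lt_in := lt_trans lt_ik (nextP k).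
rewrite bE addrAC vvalD_gt ?vval_mu_theta //.
(* [next] is only some larger index, not assumed monotone, so all three orders occur. *)
case: (ltgtP (next i) (next k)) => [lt_n|lt_n|->].
- by apply: aP => //; apply: nextP.
- rewrite [X in vlt _ X]vvalBC -(vval_theta le0i lt_in).
  exact: aP.
- by rewrite subrr vval0; case: (vval (theta i)) lt_th.
Qed.

Lemma pc_seq_perturb : pc_seq b.
Proof.
exists i0 => i j k le0i lt_ij lt_jk; have le0j := le_trans le0i (ltW lt_ij).
by rewrite !vval_perturb // theta_lt.
Qed.

(** A pseudo-limit of [a] is closer to [a (next i)] than [theta i], hence equally far from [a i] and
    [b i]. Conversely, if [b] tends to [x], its distance to [b l] is that of [theta l], and [a k] is
    compared with [x] through [b (next k)]. *)
Lemma pseudolim_perturb x : pseudolim a x <-> pseudolim b x.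
Proof.
split=> -[i1 xP].
- have vx i : (i1 <= i)%O -> vval (x - b i) = vval (x - a i).
    move=> le1i; have lt_x := xP _ _ le1i (nextP i).
    have vth : vval (theta i) = vval (x - a i).
      rewrite -(vvalBl lt_x); congr vval; rewrite /theta.
      by rewrite opprB [RHS]addrC addrA subrK.
    rewrite bE opprD addrA [LHS]vvalDr vvalN vval_mu_theta // vth //.
  by exists i1 => i j le1i lt_ij; rewrite !vx ?xP // (le_trans le1i) // ltW.
exists (Order.max i0 i1) => i j; rewrite ge_max => /andP[le0i le1i] lt_ij.
have vx k : (i0 <= k)%O -> (i1 <= k)%O -> vval (x - a k) = vval (theta k).
  move=> le0k le1k; have lt_kn := nextP k.
  have vb l : (i0 <= l)%O -> (i1 <= l)%O -> vval (x - b l) = vval (theta l).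
    move=> le0l le1l; rewrite -(vval_perturb le0l (nextP l)).
    rewrite -(vvalBl (xP _ _ le1l (nextP l))); congr vval.
    by rewrite opprB [LHS]addrC addrA subrK.
  rewrite -(subrK (b (next k)) x) -addrA [LHS]vvalDr vval_perturb_base //.
  rewrite vb ?theta_lt //; last exact: le_trans le1k (ltW lt_kn).
  exact: le_trans le0k (ltW lt_kn).
by rewrite !vx ?theta_lt // (le_trans _ (ltW lt_ij)).
Qed.

End OneField.

Lemma pc_equiv_perturb (K : valuedField) (a b mu : I -> K) : pc_seq a ->
  (forall i, vval (mu i) = Some 0) ->
  (forall i, b i = a (next i) + mu i * (a (next i) - a i)) ->
  pc_equiv a b.
Proof.
move=> [i0 aP] mu_unit bE K' f x.
apply: (@pseudolim_perturb _ _ _ (fun i => f (mu i)) i0) => [i j k *|i|i].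
- by rewrite -!rmorphB vlt_ext aP.
- exact: vval_ext_unit.
- by rewrite bE rmorphD rmorphM rmorphB.
Qed.

End Perturbation.

(** * Generic perturbations near the pseudo-limit *)

Section GenericPerturbation.
Variables (K K' : vdField) (f : mvdfExt K K') (a' : K').

Definition sp_ext (Q : sigma_poly K) : {mpoly K'[(tag (sp_map f Q)).+1]} :=
  sp_shift (sp_map f Q) a'.

Lemma sp_ext_nonconst Q : sp_nonconst Q -> forall c, sp_ext Q <> c%:MP.
Proof.
move=> Qnc; apply: sp_shift_nonconst; last exact: sp_map_nonconst.
exact: mvdf_pchar (mext_mvdf f).
Qed.

Lemma sp_ext_evalB Q y :
  (sp_ext Q).@[fun i => iter i (vsigma K') y] - (sp_ext Q)@_0%MM =
  sp_eval (sp_map f Q) (a' + y) - sp_eval (sp_map f Q) a'.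
Proof. by rewrite mcoeff0_sp_shift -sp_evalD. Qed.

Definition attains_dominant (Q : sigma_poly K) (theta y : K') : Prop :=
  exists2 m, dominant (sp_ext Q) theta m &
    vval (sp_eval (sp_map f Q) y - sp_eval (sp_map f Q) a') =
    vval (sigma_term (sp_ext Q) theta m).

Lemma generic_perturbation (Qs : seq (sigma_poly K)) (x theta : K) :
  axiom2 K -> theta != 0 -> vlt (vval (f theta)) (vval (f x - a')) ->
  exists2 mu : K, vval mu = Some 0 &
    forall Q, Q \in Qs -> sp_nonconst Q ->
      attains_dominant Q (f theta) (f (x + mu * theta)).
Proof.
move=> ax2 theta0 x_close; have ftheta0 : f theta != 0 by rewrite fmorph_eq0.
(* The reductions depend on [theta] only, so the finite list is collected before [mu] is chosen. *)
suff [s s_neq0 sP] : exists2 s : seq {n : nat & {mpoly (vresidue K')[n.+1]}},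
    forall G, G \in s -> tagged G != 0 &
    forall mu : K, vval mu = Some 0 ->
      (forall G, G \in s -> (tagged G).@[fun l : 'I_(tag G).+1 =>
         vres (iter l (vsigma K') (f mu))] != 0) ->
      forall Q, Q \in Qs -> sp_nonconst Q ->
        attains_dominant Q (f theta) (f (x + mu * theta)).
  have [mu mu_unit muP] := generic_residue f ax2 s_neq0.
  by exists mu => // Q QQs; apply: sP.
elim: Qs => [|Q Qs [s s_neq0 sP]]; first by exists [::].
(* A constant [Q] imposes no condition and contributes no reduction. *)
have [Qnc|Qc] := excluded_middle_informative (sp_nonconst Q); last first.
  exists s => // mu mu_unit muP R; rewrite inE => /orP[/eqP->|]; last exact: sP.
  by move=> Rnc; case: Qc.
have [m mdom] := dominant_exists (f theta) (sp_ext_nonconst Qnc).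
have [G G0 GP] := dominant_reduction ftheta0 mdom.
exists (Tagged (fun n => {mpoly (vresidue K')[n.+1]}) G :: s) => [R|].
  by rewrite inE => /orP[/eqP->|/s_neq0].
move=> mu mu_unit muP R; rewrite inE => /orP[/eqP->|RQs] Rnc; last first.
  by apply: sP => // H Hs; apply: muP; rewrite inE Hs orbT.
(* The new point is [a' + theta * (mu + eps)] with [eps] of positive value, so [mu + eps] and [mu]
   have conjugates with the same residues. *)
exists m => //; pose eps := (f x - a') / f theta.
have eps_small : vlt (Some 0) (vval eps).
  by rewrite -(vval1 K') -(vlt_mul2l _ _ ftheta0) mulr1 mulrC divfK.
have Omu : f mu \in vring K' by rewrite vringE vval_ext_unit ?vle_refl.
have -> : f (x + mu * theta) = a' + f theta * (f mu + eps).
  rewrite mulrDr [f theta * eps]mulrC divfK // addrCA [a' + _]addrC subrK.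
  by rewrite rmorphD rmorphM [RHS]addrC [f mu * _]mulrC.
rewrite -sp_ext_evalB; apply: GP.
  by rewrite vringD // vringE vltW.
have := muP _ (mem_head _ _); congr (_ != 0); apply: meval_eq => i /=.
by rewrite iter_sigmaD vres_small ?vring_iter_sigma ?small_iter_sigma.
Qed.

(** This bound requires no genericity of [y]; it will be applied to the original terms [a j]. *)
Lemma vle_sp_ext Q (y theta : K') m : theta != 0 ->
  vle (vval theta) (vval (y - a')) -> dominant (sp_ext Q) theta m ->
  vle (vval (sigma_term (sp_ext Q) theta m))
      (vval (sp_eval (sp_map f Q) y - sp_eval (sp_map f Q) a')).
Proof.
move=> theta0; rewrite vle_div // => Ou /(vle_dominant theta0 Ou).
by rewrite mulrC divfK // sp_ext_evalB [a' + _]addrC subrK.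
Qed.

End GenericPerturbation.

(** * Choice of the perturbed sequence and its pseudo-limits *)

Theorem theorem4p5 (K : vdField) (hK : multiplicative_vdf K) (hK2 : axiom2 K)
    (halg : rho_algebraic K)
    (d : Order.disp_t) (I : orderType d) (hI : limit_order I)
    (a : I -> K) (ha : pc_seq a)
    (K' : vdField) (f : mvdfExt K K') (a' : K')
    (ha' : pseudolim (fun i => f (a i)) a')
    (P : sigma_poly K)
    (hP0 : pseudolim (fun i => sp_eval P (a i)) 0)
    (hPL : forall (L : 'X_{1..(tag P).+1}) (b : I -> K),
      (1 <= mdeg L)%N -> pc_seq b -> pc_equiv a b ->
      ~ pseudolim (fun i => sp_eval (sp_taylor P L) (b i)) 0)
    (Sigma : seq (sigma_poly K)) :
  exists b : I -> K,
    [/\ pc_seq b, pc_equiv a b,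
        pseudolim (fun i => sp_eval P (b i)) 0
      & forall Q : sigma_poly K, Q \in Sigma -> sp_nonconst Q ->
          pseudolim (fun i => f (sp_eval Q (b i))) (sp_eval (sp_map f Q) a')].
Proof.
have [_ _ next_ex] := hI; have [i0 aP] := ha; have [i1 a'P] := ha'.
pose next (i : I) := epsilon (inhabits i) (fun j => i < j)%O.
have nextP i : (i < next i)%O.
  exact: (epsilon_spec (inhabits i) (fun j => i < j)%O (next_ex i)).
pose theta i := a (next i) - a i.
(* [P] joins [Sigma] so that one unit serves both; conditions are imposed only beyond [i0] and [i1],
   and earlier the unit 1 will do. *)
pose good i mu := vval mu = Some 0 /\ ((i0 <= i)%O -> (i1 <= i)%O ->
  forall Q, Q \in P :: Sigma -> sp_nonconst Q ->
    attains_dominant f a' Q (f (theta i)) (f (a (next i) + mu * theta i))).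
have theta_vlt i k : (i0 <= i)%O -> (i < k)%O ->
    vlt (vval (theta i)) (vval (theta k)) by move=> le0i lt_ik; exact: (theta_lt nextP aP).
have theta0 i : (i0 <= i)%O -> theta i != 0.
  by move=> le0i; apply: vlt_neq0 (theta_vlt _ _ le0i (nextP i)).
have vftheta i : (i1 <= i)%O -> vval (f (theta i)) = vval (f (a i) - a').
  move=> le1i; rewrite vvalBC -(vvalBl (a'P _ _ le1i (nextP i))); congr vval.
  by rewrite opprB [RHS]addrC addrA subrK rmorphB.
have good_ex i : exists mu, good i mu.
  have [/andP[le0i le1i]|] := boolP ((i0 <= i)%O && (i1 <= i)%O).
    have [|mu mu_unit muP] := @generic_perturbation _ _ f a' (P :: Sigma)
        (a (next i)) (theta i) hK2 (theta0 _ le0i).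
      by rewrite vftheta // vvalBC [X in vlt _ X]vvalBC a'P.
    by exists mu.
  move=> early; exists 1; split=> [|le0i le1i]; first exact: vval1.
  by rewrite le0i le1i in early.
pose mu i := epsilon (inhabits 0) (good i).
have muP i : good i (mu i) := epsilon_spec (inhabits 0) _ (good_ex i).
pose b i := a (next i) + mu i * theta i.
have mu_unit i : vval (mu i) = Some 0 by case: (muP i).
pose start := Order.max i0 i1.
have startP i : (start <= i)%O -> (i0 <= i)%O /\ (i1 <= i)%O.
  by rewrite /start ge_max => /andP.
have bP Q i : Q \in P :: Sigma -> sp_nonconst Q -> (start <= i)%O ->
    attains_dominant f a' Q (f (theta i)) (f (b i)).
  by move=> QS Qnc /startP[le0i le1i]; case: (muP i) => _; apply.
have incr Q i j : Q \in P :: Sigma -> sp_nonconst Q ->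
    (start <= i)%O -> (i < j)%O ->
    vlt (vval (sp_eval (sp_map f Q) (f (b i)) - sp_eval (sp_map f Q) a'))
        (vval (sp_eval (sp_map f Q) (f (b j)) - sp_eval (sp_map f Q) a')).
  move=> QS Qnc lei lt_ij; have [le0i le1i] := startP _ lei.
  have [m mdom ->] := bP Q i QS Qnc lei.
  have [m' m'dom ->] := bP Q j QS Qnc (le_trans lei (ltW lt_ij)).
  by apply: dominant_lt mdom m'dom; rewrite vlt_ext theta_vlt.
exists b; split.
- exact: (pc_seq_perturb nextP aP mu_unit).
- exact: (pc_equiv_perturb nextP ha mu_unit).
(* A constant sequence cannot pseudo-converge to 0, its values failing to increase. *)
- have Pnc : sp_nonconst P.
    case=> c Pc; have [i2 /(_ i2 _ (lexx _) (nextP _))] := hP0.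
    by rewrite /sp_eval Pc !mevalC vlt_irr.
  have PS : P \in P :: Sigma by rewrite mem_head.
  pose Pa' := sp_eval (sp_map f P) a'.
  have Pa'_large i : (start <= i)%O ->
      vlt (vval (sp_eval (sp_map f P) (f (b i)) - Pa')) (vval Pa').
    move=> lei; apply/negPn/negP => /vltNgeP le_Pa'.
    have [i2 Pi2] := hP0.
    (* If [P a'] had value at most that of [P (b i) - P a'], then beyond [i] the difference
       [P (a j) - P a'] would have larger value than [P a'], and [P (a j)] would have constant
       value. *)
    have vPa j : (i < j)%O -> vval (f (sp_eval P (a j))) = vval Pa'.
      move=> lt_ij; have lej := le_trans lei (ltW lt_ij).
      have [le0j le1j] := startP _ lej.
      have lt_Pa' := vle_lt_trans le_Pa' (incr P i j PS Pnc lei lt_ij).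
      have [m mdom vb] := bP P j PS Pnc lej; rewrite vb in lt_Pa'.
      have ftheta0 : f (theta j) != 0 by rewrite fmorph_eq0 theta0.
      have le_theta : vle (vval (f (theta j))) (vval (f (a j) - a')).
        by rewrite vftheta ?vle_refl.
      have := vlt_le_trans lt_Pa' (vle_sp_ext ftheta0 le_theta mdom).
      by rewrite -/Pa' -sp_eval_map => /vvalDr; rewrite subrK.
    (* Two indices beyond both [i] and [i2] with equal values contradict [P (a i) ~> 0]. *)
    pose j := next (Order.max i i2).
    have lt_mj : (Order.max i i2 < j)%O := nextP _.
    have lt_ij : (i < j)%O by apply: le_lt_trans lt_mj; rewrite le_max lexx.
    have lt_2j : (i2 < j)%O.
      by apply: le_lt_trans lt_mj; rewrite le_max lexx orbT.
    have := Pi2 j (next j) (ltW lt_2j) (nextP j).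
    rewrite !sub0r !vvalN -(vlt_ext f) (vPa _ lt_ij).
    by rewrite (vPa _ (lt_trans lt_ij (nextP j))) vlt_irr.
  exists start => i j lei lt_ij; rewrite !sub0r !vvalN -(vlt_ext f).
  have vPb k : (start <= k)%O -> vval (f (sp_eval P (b k))) =
      vval (sp_eval (sp_map f P) (f (b k)) - Pa').
    by move=> /Pa'_large/vvalDl; rewrite subrK sp_eval_map.
  by rewrite !vPb ?incr // (le_trans lei) // ltW.
move=> Q QS Qnc; exists start => i j lei lt_ij.
rewrite !(vvalBC (sp_eval _ _)) -!sp_eval_map incr //.
by rewrite inE QS orbT.
Qed.
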